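(* Let $\mathbf{R}$ be a real closed field, let $a, b \in \mathbf{R}$ with $a < b$ and let $P, Q \in \mathbf{R}[X] \setminus \{0\}$ with $\deg P = p \ge 1$ and $\deg Q = q < p$. If $a$ and $b$ are not common roots of $P$ and $Q$ (i.e. neither $a$ nor $b$ is a common root of $P$ and $Q$), then, with $s$, $d_i$, $T_i$, $t_i$, $\mathrm{p}(i)$ and $\epsilon_n$ associated to $P$ and $Q$ as in the context, $$ \mathrm{Ind}_a^b\Big(\frac{Q}{P}\Big) = \sum_{0 \le i \le s-1} \epsilon_{d_{\mathrm{p}(i) - 1} - d_i}\cdot \mathrm{sign}(t_{\mathrm{p}(i)}) \cdot \mathrm{sign}(t_i) \cdot \mathrm{Var}_a^b(T_i, T_{i+1}). $$
   Context: $\mathbf{R}$ is a real closed field; $\mathrm{sign}(y)\in\{-1,0,1\}$ is the sign of $y \in \mathbf{R}$. **Cauchy index.** Let $x\in\mathbf{R}$ and $F,G\in\mathbf{R}[X]\setminus\{0\}$. Write uniquely $\frac{G}{F} = (X-x)^m \frac{\widetilde G}{\widetilde F}$ with $m\in\mathbb{Z}$, $\widetilde F$ monic, $\widetilde F,\widetilde G \in \mathbf{R}[X]$ coprime, $\widetilde F(x)\neq 0$, $\widetilde G(x)\ne 0$. If $m<0$, set $\mathrm{Ind}_x^+(\frac GF)=\frac12\mathrm{sign}\big(\frac{\widetilde G(x)}{\widetilde F(x)}\big)$ and $\mathrm{Ind}_x^-(\frac GF)=\frac12(-1)^m\mathrm{sign}\big(\frac{\widetilde G(x)}{\widetilde F(x)}\big)$;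 if $m\ge 0$, both are $0$. Set $\mathrm{Ind}_x(\frac GF)=\mathrm{Ind}_x^+(\frac GF)-\mathrm{Ind}_x^-(\frac GF)$. For $a<b$ in $\mathbf{R}$, $$\mathrm{Ind}_a^b\Big(\frac GF\Big)=\mathrm{Ind}_a^+\Big(\frac GF\Big)+\sum_{x\in(a,b)}\mathrm{Ind}_x\Big(\frac GF\Big)-\mathrm{Ind}_b^-\Big(\frac GF\Big)$$ (only the finitely many roots of $F$ in $(a,b)$ contribute). **Sign variation.** For $x\in\mathbf{R}$ and $F,G\in\mathbf{R}[X]$, $\mathrm{Var}_x(F,G)=\frac12\big|\mathrm{sign}(F(x))-\mathrm{sign}(G(x))\big|$, and for $a<b$, $\mathrm{Var}_a^b(F,G)=\mathrm{Var}_a(F,G)-\mathrm{Var}_b(F,G)$. **Sturm sequence.** For $P,Q\in\mathbf{R}[X]\setminus\{0\}$: $S_0=P$, $S_1=Q$, $S_{i+1}=-\mathrm{Rem}(S_{i-1},S_i)$ (remainder of the Euclidean division of $S_{i-1}$ by $S_i$), and $s$ is the index such that $S_1,\dots,S_s\neq0$ and $S_{s+1}=0$. Let $d_i=\deg S_i$ for $0\le i\le s$ and $d_{-1}=p+1$ (so $d_0=p$, $d_1=q$). **Subresultants.** Let $\deg P=p\ge1$, $\deg Q=q<p$. For $0\le j\le q$, $\mathrm{sResP}_j(P,Q)\in\mathbf{R}[X]$ is the determinant of the $(p+q-2j)\times(p+q-2j)$ matrix whose rows correspond, from top to bottom, to the polynomials $X^{q-j-1}P,\dots,XP,P,Q,XQ,\dots,X^{p-j-1}Q$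 (in this order); in each row the first $p+q-2j-1$ entries are the coefficients of $X^{p+q-j-1},X^{p+q-j-2},\dots,X^{j+1}$ in the corresponding polynomial, and the last entry is the polynomial itself. By convention $\mathrm{sResP}_p(P,Q)=P$, $\mathrm{sResP}_{p-1}(P,Q)=Q$, and $\mathrm{sResP}_j(P,Q)=0$ for $q<j<p-1$. Set $T_0=P$, $t_0=1$ (even if $P$ is not monic), and for $1\le i\le s$, $T_i=\mathrm{sResP}_{d_{i-1}-1}(P,Q)$ and $t_i=$ the leading coefficient of $T_i$. (So $T_1=Q$; by the known Structure Theorem of Subresultants, each $T_i$ is nonzero of degree $d_i$.) **Further notation.** For $n\in\mathbb{Z}$, $\epsilon_n=(-1)^{\frac12 n(n-1)}$. For $0\le i\le s$, $\mathrm{p}(i)=\max\{j \mid 0\le j\le i,\ d_{j-1}-d_j \text{ is odd}\}$ (well defined since $d_{-1}-d_0=1$). *)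

(* Defs.v *)
From HB Require Import structures.
From mathcomp Require Import all_boot all_order all_algebra.
From mathcomp Require Import polyorder polyrcf.

Set Implicit Arguments.
Unset Strict Implicit.
Unset Printing Implicit Defensive.

Import Order.TTheory GRing.Theory Num.Theory.
Local Open Scope ring_scope.

(* Signs, half-integers and the numbers epsilon_n are all taken in R itself
   (Num.sg is R-valued): R has characteristic 0, so no information is lost. *)

Definition pdeg (R : rcfType) (F : {poly R}) : nat := (size F).-1.

Local Notation "p %:F" := (tofrac p) (at level 1, format "p %:F").

(* The decomposition G / F = (X - x)^m * (Gt / Ft), in the field R(X). *)
Definition local_form (R : rcfType) (x : R) (F G : {poly R})
    (m : int) (Ft Gt : {poly R}) : Prop :=
  [/\ G%:F / F%:F = ('X - x%:P)%:F ^ m * (Gt%:F / Ft%:F),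
      Ft \is monic,
      coprimep Ft Gt,
      Ft.[x] != 0
    & Gt.[x] != 0].

(* Its components; local_form_exists and local_form_unique below show that
   they are the only ones satisfying local_form. *)
Definition local_ord (R : rcfType) (x : R) (F G : {poly R}) : int :=
  (\mu_x G)%:Z - (\mu_x F)%:Z.

Definition strip_root (R : rcfType) (x : R) (F : {poly R}) : {poly R} :=
  F %/ ('X - x%:P) ^+ \mu_x F.

Definition local_den (R : rcfType) (x : R) (F G : {poly R}) : {poly R} :=
  let F1 := strip_root x (F %/ gcdp F G) in (lead_coef F1)^-1 *: F1.

Definition local_num (R : rcfType) (x : R) (F G : {poly R}) : {poly R} :=
  let F1 := strip_root x (F %/ gcdp F G) in
  (lead_coef F1)^-1 *: strip_root x (G %/ gcdp F G).

Lemma strip_rootK (R : rcfType) (x : R) (F : {poly R}) :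
  F = strip_root x F * ('X - x%:P) ^+ \mu_x F.
Proof. by rewrite /strip_root divpK // root_mu. Qed.

Lemma strip_rootN (R : rcfType) (x : R) (F : {poly R}) :
  F != 0 -> (strip_root x F).[x] != 0.
Proof.
move=> F0; have := mu_spec x F0 => -[q qx eF].
rewrite /strip_root {1}eF mulpK //.
by rewrite expf_neq0 // polyXsubC_eq0.
Qed.

Lemma local_form_exists (R : rcfType) (x : R) (F G : {poly R}) :
  F != 0 -> G != 0 ->
  local_form x F G (local_ord x F G) (local_den x F G) (local_num x F G).
Proof.
move=> F0 G0; rewrite /local_form /local_ord /local_den /local_num.
set D := gcdp F G.
have D0 : D != 0 by rewrite gcdp_eq0 negb_and F0.
have eF : F = (F %/ D) * D by rewrite divpK // dvdp_gcdl.
have eG : G = (G %/ D) * D by rewrite divpK // dvdp_gcdr.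
set F1 := F %/ D in eF *; set G1 := G %/ D in eG *.
have F10 : F1 != 0 by apply: contraNneq F0 => e; rewrite eF e mul0r.
have G10 : G1 != 0 by apply: contraNneq G0 => e; rewrite eG e mul0r.
have muF : \mu_x F = (\mu_x F1 + \mu_x D)%N by rewrite {1}eF mu_mul ?mulf_neq0.
have muG : \mu_x G = (\mu_x G1 + \mu_x D)%N by rewrite {1}eG mu_mul ?mulf_neq0.
have sF0 := strip_rootN x F10; have sG0 := strip_rootN x G10.
have eF1 := strip_rootK x F1; have eG1 := strip_rootK x G1.
have F20 : strip_root x F1 != 0.
  by apply: contraNneq F10 => e; rewrite eF1 e mul0r.
have lc0 : (lead_coef (strip_root x F1))^-1 != 0 by rewrite invr_eq0 lead_coef_eq0.
split.
- have Y0 : ('X - x%:P)%:F != 0 :> {fraction {poly R}}.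
    by rewrite tofrac_eq0 polyXsubC_eq0.
  have -> : (\mu_x G)%:Z - (\mu_x F)%:Z = (\mu_x G1)%:Z - (\mu_x F1)%:Z.
    by rewrite muF muG !PoszD opprD addrACA subrr addr0.
  rewrite expfzDr // -invr_expz -!exprnP -!tofracXn.
  rewrite {1}eF {1}eG !tofracM -mulf_div divff ?tofrac_eq0 // mulr1.
  rewrite {1}eF1 {1}eG1 -!mul_polyC !tofracM -!mulf_div.
  by rewrite divff ?tofrac_eq0 ?polyC_eq0 // mul1r mulrC.
- by rewrite monicE lead_coefZ mulVf // lead_coef_eq0.
- rewrite coprimepZl // coprimepZr //.
  have cFG : coprimep F1 G1 by rewrite coprimep_div_gcd // F0.
  have dF : strip_root x F1 %| F1 by rewrite {2}eF1 dvdp_mulr.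
  have dG : strip_root x G1 %| G1 by rewrite {2}eG1 dvdp_mulr.
  exact: coprimep_dvdr dF (coprimep_dvdl dG cFG).
- by rewrite hornerZ mulf_neq0.
- by rewrite hornerZ mulf_neq0.
Qed.

Lemma local_form_unique (R : rcfType) (x : R) (F G : {poly R})
    (m m' : int) (Ft Gt Ft' Gt' : {poly R}) :
  local_form x F G m Ft Gt -> local_form x F G m' Ft' Gt' ->
  [/\ m = m', Ft = Ft' & Gt = Gt'].
Proof.
wlog le_mm : m m' Ft Gt Ft' Gt' / m' <= m.
  move=> H h h'; case/orP: (le_total m' m) => le; first exact: (H m m').
  by have [-> -> ->] := H m' m _ _ _ _ le h' h.
case=> e mF cF Fx Gx [e' mF' cF' Fx' Gx'].
have Y0 : ('X - x%:P)%:F != 0 :> {fraction {poly R}}.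
  by rewrite tofrac_eq0 polyXsubC_eq0.
have [k ek] : exists k : nat, m = m' + k%:Z.
  exists `|m - m'|%N; have /gez0_abs -> : 0 <= m - m' by rewrite subr_ge0.
  by rewrite [RHS]addrC subrK.
have F0 := monic_neq0 mF; have F0' := monic_neq0 mF'.
have E : ('X - x%:P) ^+ k * Gt * Ft' = Gt' * Ft.
  apply/eqP; rewrite -tofrac_eq !tofracM tofracXn; apply/eqP.
  move: e; rewrite e' ek expfzDr // -[RHS]mulrA => e.
  have {e} := mulfI (expfz_neq0 _ Y0) e.
  rewrite -exprnP mulrA => /eqP.
  by rewrite eqr_div ?tofrac_eq0 // => /eqP <-.
have k0 : k = 0%N.
  case: k E {ek} => // k /(congr1 (horner^~ x)).
  rewrite !hornerM horner_exp hornerXsubC subrr exprS !mul0r => /esym/eqP.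
  by rewrite mulf_eq0 (negPf Gx') (negPf Fx).
move: E ek; rewrite k0 expr0 mul1r addr0 => E em.
have eqF : Ft = Ft'.
  apply/eqP; rewrite -eqp_monic // /eqp.
  rewrite -(Gauss_dvdpr Ft' cF) E dvdp_mull //=.
  by rewrite -(Gauss_dvdpr Ft cF') -E dvdp_mull.
by split=> //; move: E; rewrite eqF => /(mulIf F0').
Qed.

Definition ind_right (R : rcfType) (G F : {poly R}) (x : R) : R :=
  if local_ord x F G < 0
  then 2^-1 * Num.sg ((local_num x F G).[x] / (local_den x F G).[x])
  else 0.

Definition ind_left (R : rcfType) (G F : {poly R}) (x : R) : R :=
  if local_ord x F G < 0
  then 2^-1 * (-1) ^ local_ord x F G
       * Num.sg ((local_num x F G).[x] / (local_den x F G).[x])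
  else 0.

Definition ind_at (R : rcfType) (G F : {poly R}) (x : R) : R :=
  ind_right G F x - ind_left G F x.

(* The index of G / F between a and b; roots F a b lists without repetition
   the roots of F in the open interval (a, b), the only points which can
   contribute to the sum. *)
Definition cauchy_index (R : rcfType) (G F : {poly R}) (a b : R) : R :=
  ind_right G F a + \sum_(x <- roots F a b) ind_at G F x - ind_left G F b.

Definition var_at (R : rcfType) (F G : {poly R}) (x : R) : R :=
  2^-1 * `|Num.sg F.[x] - Num.sg G.[x]|.

Definition var_between (R : rcfType) (F G : {poly R}) (a b : R) : R :=
  var_at F G a - var_at F G b.

Fixpoint sturm_pair (R : rcfType) (P Q : {poly R}) (i : nat) :
    {poly R} * {poly R} :=
  if i is i'.+1 then
    let: (A, B) := sturm_pair P Q i' in (B, - (A %% B))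
  else (P, Q).

Definition sturm (R : rcfType) (P Q : {poly R}) (i : nat) : {poly R} :=
  (sturm_pair P Q i).1.

Lemma sturm0 (R : rcfType) (P Q : {poly R}) : sturm P Q 0 = P.
Proof. by []. Qed.

Lemma sturm1 (R : rcfType) (P Q : {poly R}) : sturm P Q 1 = Q.
Proof. by []. Qed.

Lemma sturmSS (R : rcfType) (P Q : {poly R}) (i : nat) :
  sturm P Q i.+2 = - (sturm P Q i %% sturm P Q i.+1).
Proof. by rewrite /sturm /=; case: (sturm_pair P Q i). Qed.

Lemma sturm_terminates (R : rcfType) (P Q : {poly R}) :
  exists i, sturm P Q i.+1 == 0.
Proof.
suff H n : (exists i, sturm P Q i.+1 == 0)
           \/ (size (sturm P Q n.+1) + n <= size Q)%N.
  case: (H (size Q)) => //; rewrite -[leqRHS]add0n leq_add2r leqn0.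
  by rewrite size_poly_eq0; exists (size Q).
elim: n => [|n [H|IH]]; [by right; rewrite addn0 | by left |].
case: (eqVneq (sturm P Q n.+1) 0) => [e|nz]; first by left; exists n; rewrite e.
right; apply: leq_trans IH; rewrite addnS -addSn leq_add2r.
by rewrite sturmSS size_polyN ltn_modp.
Qed.

(* The index s such that S_1, ..., S_s are nonzero and S_{s+1} = 0. *)
Definition sturm_length (R : rcfType) (P Q : {poly R}) : nat :=
  ex_minn (sturm_terminates P Q).

Definition sturm_deg (R : rcfType) (P Q : {poly R}) (i : nat) : nat :=
  pdeg (sturm P Q i).

(* d_{i-1}, with d_{-1} = p + 1. *)
Definition sturm_deg_pred (R : rcfType) (P Q : {poly R}) (i : nat) : nat :=
  if i is i'.+1 then sturm_deg P Q i' else (pdeg P).+1.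

(* Polynomial in row k of the j-th subresultant matrix:
   X^(q-j-1) P, ..., X P, P, Q, X Q, ..., X^(p-j-1) Q. *)
Definition sres_row (R : rcfType) (P Q : {poly R}) (j k : nat) : {poly R} :=
  let q := pdeg Q in
  if (k < q - j)%N then 'X^(q - j - 1 - k) * P else 'X^(k - (q - j)) * Q.

(* For j <= q <= p the size below is p + q - 2j. *)
Definition sres_mx (R : rcfType) (P Q : {poly R}) (j : nat) :
    'M[{poly R}]_((pdeg Q - j) + (pdeg P - j)) :=
  let p := pdeg P in let q := pdeg Q in
  \matrix_(k, l)
    if (l.+1 == (q - j) + (p - j))%N then sres_row P Q j k
    else ((sres_row P Q j k)`_(p + q - j - 1 - l))%:P.

(* Meaningful for q < p and j <= p; when j = q = p - 1 the determinant is the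
   1 x 1 determinant Q, in accordance with the convention for j = p - 1. *)
Definition sResP (R : rcfType) (P Q : {poly R}) (j : nat) : {poly R} :=
  let p := pdeg P in let q := pdeg Q in
  if (j <= q)%N then \det (sres_mx P Q j)
  else if j == p then P
  else if j == p.-1 then Q
  else 0.

Definition sres_T (R : rcfType) (P Q : {poly R}) (i : nat) : {poly R} :=
  if i is 0 then P else sResP P Q (sturm_deg_pred P Q i).-1.

(* t_0 = 1 even when P is not monic. *)
Definition sres_t (R : rcfType) (P Q : {poly R}) (i : nat) : R :=
  if i is 0 then 1 else lead_coef (sres_T P Q i).

(* n (n - 1) is even, so the integer quotient is exact. *)
Definition eps (R : rcfType) (n : int) : R := (-1) ^ (n * (n - 1) %/ 2)%Z.

(* max { j | 0 <= j <= i, d_{j-1} - d_j odd }; the set always contains 0. *)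
Definition odd_index (R : rcfType) (P Q : {poly R}) (i : nat) : nat :=
  \max_(j < i.+1 |
        odd `|(sturm_deg_pred P Q j)%:Z - (sturm_deg P Q j)%:Z|%N) j.

(* Main.v *)
Require Import Defs.
From mathcomp Require Import all_boot all_order all_fingroup all_algebra.
From mathcomp Require Import polyorder polyrcf ring zify.
Set Implicit Arguments.
Unset Strict Implicit.
Unset Printing Implicit Defensive.
Import Order.TTheory GRing.Theory Num.Theory.
Local Open Scope ring_scope.

(** Write S_i for the Sturm sequence of P and Q, and d_i for the degrees.

The index is first computed along the S_i. At a point x the indices of G / F
and F / G add up to half the jump of the sign of F G across x. Since that sign
is constant between two consecutive roots of F G, the jumps telescope over
(a, b), and the two ends contribute exactly Var_a^b(F, G) as long as neither
end is a common root; this is [cauchy_index_inversion]. On the other hand G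
and its remainder modulo F have the same leading term at every pole of G / F
([cauchy_index_modp]). Alternating the two facts along the Euclidean algorithm
gives Ind(Q / P) as the sum of the Var_a^b(S_i, S_{i+1})
([cauchy_index_sturm]).

It remains to compare T_i with S_i. Row operations on the determinant which
defines the subresultants turn the pair (P, Q) into (Q, - Rem(P, Q)) at the
cost of an explicit scalar ([sylv_modp]). After enough steps the determinant
is of size 1, which yields T_i = c_i S_i with c_i an explicit product of powers
of leading coefficients ([sres_T_sturm]). Multiplying two polynomials without
common root at a and b by c and c' multiplies their Var_a^b by the sign of
c c' ([var_betweenZ]), so only the sign e_i of c_i c_{i+1} matters. With
delta = d_i - d_{i+1}, the formula for the c_i reads
  e_{i+1} = epsilon_delta (sign(t_i) sign(t_{i+1}) e_i) ^ (delta + 1)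
([sgr_coef_step]). If delta is odd the power is 1 and e_{i+1} = epsilon_delta:
the recursion forgets the past, which is why the last odd drop p(i) appears.
If delta is even, e_i is multiplied by epsilon_delta sign(t_i) sign(t_{i+1}),
and epsilon_{D + delta} = epsilon_D epsilon_delta merges the epsilons. Hence
e_i is the coefficient in the theorem ([sgr_coef_odd_index]). *)

(** * One-sided signs and local indices *)

(** The sign of F immediately to the left of x: it is the sign to the right,
reversed when the multiplicity of the root x is odd. *)
Definition sgp_left (R : rcfType) (F : {poly R}) (x : R) : R :=
  (-1) ^+ \mu_x F * sgp_right F x.

(** To the right of x the stripped factor X - x is positive. *)
Lemma sgp_right_strip (R : rcfType) (x : R) (F : {poly R}) :
  F != 0 -> sgp_right F x = Num.sg (strip_root x F).[x].
Proof.
move=> F0; have sF := strip_rootN x F0.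
rewrite {1}(strip_rootK x F) sgp_right_mul sgp_rightNroot // -[RHS]mulr1.
congr (_ * _); elim: (\mu_x F) => [|n IH].
  by rewrite expr0 -polyC1 sgp_rightc sgr1.
rewrite exprS sgp_right_mul IH mulr1 sgp_right_rec polyXsubC_eq0.
by rewrite root_XsubC eqxx /= derivXsubC -polyC1 sgp_rightc sgr1.
Qed.

Lemma local_ord_lt0 (R : rcfType) (x : R) (F G : {poly R}) :
  (local_ord x F G < 0) = (\mu_x G < \mu_x F)%N.
Proof. by rewrite /local_ord subr_lt0 ltz_nat. Qed.

(** Clearing the gcd and passing from a quotient to a product multiply by
squares, which is invisible on signs. *)
Lemma sgr_local (R : rcfType) (x : R) (F G : {poly R}) :
  F != 0 -> G != 0 ->
  Num.sg ((local_num x F G).[x] / (local_den x F G).[x]) =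
  sgp_right (F * G) x.
Proof.
move=> F0 G0; rewrite /local_num /local_den.
set D := gcdp F G.
have D0 : D != 0 by rewrite gcdp_eq0 negb_and F0.
have eF : F = (F %/ D) * D by rewrite divpK // dvdp_gcdl.
have eG : G = (G %/ D) * D by rewrite divpK // dvdp_gcdr.
set F1 := F %/ D in eF *; set G1 := G %/ D in eG *.
have F10 : F1 != 0 by apply: contraNneq F0 => e; rewrite eF e mul0r.
have G10 : G1 != 0 by apply: contraNneq G0 => e; rewrite eG e mul0r.
have sF0 := strip_rootN x F10.
have lc0 : (lead_coef (strip_root x F1))^-1 != 0.
  rewrite invr_eq0 lead_coef_eq0.
  by apply: contraNneq sF0 => ->; rewrite horner0.
rewrite !hornerZ -mulf_div divff // mul1r sgrM sgrV -!sgp_right_strip //.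
rewrite eF eG !sgp_right_mul mulrACA sgp_right_square // mulr1.
exact: mulrC.
Qed.

Lemma ind_rightE (R : rcfType) (x : R) (F G : {poly R}) :
  F != 0 -> G != 0 ->
  ind_right G F x =
    if (\mu_x G < \mu_x F)%N then 2^-1 * sgp_right (F * G) x else 0.
Proof. by move=> F0 G0; rewrite /ind_right local_ord_lt0 sgr_local. Qed.

Lemma ind_leftE (R : rcfType) (x : R) (F G : {poly R}) :
  F != 0 -> G != 0 ->
  ind_left G F x =
    if (\mu_x G < \mu_x F)%N then 2^-1 * sgp_left (F * G) x else 0.
Proof.
move=> F0 G0; rewrite /ind_left local_ord_lt0 sgr_local // /sgp_left.
rewrite mu_mul ?mulf_neq0 // -mulrA /local_ord.
have n1 : (-1 : R) != 0 by rewrite oppr_eq0 oner_eq0.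
by rewrite expfzDr // -invr_expz -!exprnP -exprVn invrN1 -exprD addnC.
Qed.

Lemma halfD (R : rcfType) : (2^-1 : R) + 2^-1 = 1.
Proof. by rewrite -mulr2n -[_ *+ 2]mulr_natr mulVf // pnatr_eq0. Qed.

(** When F and G do not vanish together, Var_x is affine in the product of the
signs: a zero of exactly one of them gives 1/2, as does the formula. This is
where the hypothesis on common roots enters. *)
Lemma var_at_half (R : rcfType) (F G : {poly R}) (x : R) :
  ~~ (root F x && root G x) ->
  var_at F G x = 2^-1 - 2^-1 * (Num.sg F.[x] * Num.sg G.[x]).
Proof.
have two : 2^-1 * `|1 + 1| = 1 :> R.
  by rewrite -[1 + 1]/(2%:R) normr_nat mulVf // pnatr_eq0.
rewrite /var_at !rootE -[F.[x] == 0]sgr_eq0 -[G.[x] == 0]sgr_eq0.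
have sgN (y : R) : [\/ Num.sg y = 0, Num.sg y = 1 | Num.sg y = -1].
  by case: (sgrP y) => _; [constructor 1 | constructor 2 | constructor 3].
by case: (sgN F.[x]) => ->; case: (sgN G.[x]) => ->; rewrite ?eqxx //= => _;
  rewrite ?(mul0r, mulr0, mul1r, mulr1, subr0, sub0r, mulN1r, mulrN1, opprK,
    normrN, normr1, subrr, normr0, mulrN, halfD) // -?opprD ?normrN two.
Qed.

(** Here s stands for a one-sided sign of F G at x; the same computation serves
both sides. If x is a root of one polynomial, exactly one of the two indices is
s / 2 and Var_x is 1/2; otherwise both indices vanish and s is the sign at x
itself. *)
Lemma ind_inversion (R : rcfType) (F G : {poly R}) (x s : R) :
  F != 0 -> G != 0 -> ~~ (root F x && root G x) ->
  (~~ root F x -> ~~ root G x -> s = Num.sg F.[x] * Num.sg G.[x]) ->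
  (if (\mu_x G < \mu_x F)%N then 2^-1 * s else 0) +
  (if (\mu_x F < \mu_x G)%N then 2^-1 * s else 0) =
    var_at F G x - 2^-1 + 2^-1 * s.
Proof.
move=> F0 G0 nr hs; rewrite var_at_half // [X in _ = X + _]addrAC subrr sub0r.
have [rF|rF] := boolP (root F x); have [rG|rG] := boolP (root G x).
- by rewrite rF rG in nr.
- rewrite (muNroot rG) mu_gt0 // rF ltn0 addr0.
  by rewrite (rootP rF) sgr0 mul0r mulr0 oppr0 add0r.
- rewrite (muNroot rF) mu_gt0 // rG ltn0 add0r.
  by rewrite (rootP rG) sgr0 mulr0 mulr0 oppr0 add0r.
- by rewrite (muNroot rF) (muNroot rG) ltnn hs // addr0 addNr.
Qed.

Lemma sgp_leftNroot (R : rcfType) (F : {poly R}) (x : R) :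
  ~~ root F x -> sgp_left F x = Num.sg F.[x].
Proof. by move=> rF; rewrite /sgp_left muNroot // mul1r sgp_rightNroot. Qed.

Lemma ind_right_inversion (R : rcfType) (F G : {poly R}) (x : R) :
  F != 0 -> G != 0 -> ~~ (root F x && root G x) ->
  ind_right G F x + ind_right F G x =
    var_at F G x - 2^-1 + 2^-1 * sgp_right (F * G) x.
Proof.
move=> F0 G0 nr; rewrite !ind_rightE // [G * F]mulrC ind_inversion // => rF rG.
by rewrite sgp_rightNroot ?rootM ?negb_or ?rF // hornerM sgrM.
Qed.

Lemma ind_left_inversion (R : rcfType) (F G : {poly R}) (x : R) :
  F != 0 -> G != 0 -> ~~ (root F x && root G x) ->
  ind_left G F x + ind_left F G x =
    var_at F G x - 2^-1 + 2^-1 * sgp_left (F * G) x.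
Proof.
move=> F0 G0 nr; rewrite !ind_leftE // [G * F]mulrC ind_inversion // => rF rG.
by rewrite sgp_leftNroot ?rootM ?negb_or ?rF // hornerM sgrM.
Qed.

(** If F and G have the same multiplicity at x neither quotient has a pole, but
then F G has even multiplicity and its sign does not jump either. *)
Lemma ind_at_inversion (R : rcfType) (F G : {poly R}) (x : R) :
  F != 0 -> G != 0 ->
  ind_at G F x + ind_at F G x =
    2^-1 * (sgp_right (F * G) x - sgp_left (F * G) x).
Proof.
move=> F0 G0; rewrite /ind_at !ind_rightE // !ind_leftE // [G * F]mulrC mulrBr.
case: ltngtP => [_|_|e]; rewrite ?(subr0, addr0, add0r) //.
rewrite /sgp_left mu_mul ?mulf_neq0 // e addnn -mul2n exprM sqrrN expr1n expr1n.
by rewrite mul1r subrr.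
Qed.

Lemma ind_at_Nroot (R : rcfType) (F G : {poly R}) (x : R) :
  ~~ root F x -> ind_at G F x = 0.
Proof.
move=> rF; rewrite /ind_at /ind_right /ind_left local_ord_lt0 (muNroot rF).
by rewrite ltn0 subr0.
Qed.

(** Enlarging the set of points from the roots of F to those of F H makes it
possible to sum the indices of G / F and F / G over the same points. *)
Lemma cauchy_sum_mulr (R : rcfType) (F G H : {poly R}) (a b : R) :
  F != 0 -> H != 0 ->
  \sum_(x <- roots F a b) ind_at G F x =
  \sum_(x <- roots (F * H) a b) ind_at G F x.
Proof.
move=> F0 H0.
have e : perm_eq (roots F a b) [seq x <- roots (F * H) a b | root F x].
  apply: uniq_perm; rewrite ?filter_uniq ?uniq_roots // => x.
  rewrite mem_filter !in_roots rootM mulf_neq0 // F0.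
  by case: (root F x).
rewrite (perm_big _ e) big_filter big_mkcond; apply: eq_bigr => x _.
by case: ifPn => // /ind_at_Nroot.
Qed.

(** * The inversion formula *)

(** Both one-sided signs are the sign at the midpoint. *)
Lemma sgp_noroot (R : rcfType) (F : {poly R}) (a b : R) :
  a < b -> F != 0 -> roots F a b = [::] -> sgp_right F a = sgp_left F b.
Proof.
move=> ab F0 rF.
have hN : next_root F a b = Num.max b a by rewrite /next_root rF (negPf F0).
have hP : prev_root F a b = Num.min a b by rewrite /prev_root rF (negPf F0).
have hm : (a + b) / 2 \in `]a, b[ by rewrite in_itv /= !midf_lt.
rewrite -(@sgr_neighpr _ b F a ((a + b) / 2)); last first.
  by rewrite /neighpr hN max_l // ltW.
rewrite (@sgr_neighpl _ a F b); last first.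
  by rewrite /neighpl hP min_l // ltW.
by rewrite /sgp_left signr_odd.
Qed.

(** The sign to the right of a root is the sign to the left of the next one. *)
Lemma sgp_telescope (R : rcfType) (F : {poly R}) (a b : R) :
  a < b -> F != 0 ->
  sgp_right F a + \sum_(x <- roots F a b) (sgp_right F x - sgp_left F x) =
  sgp_left F b.
Proof.
move=> ab F0; move e: (roots F a b) => s.
elim: s a ab e => [|x s IH] a ab e.
  by rewrite big_nil addr0; apply: sgp_noroot.
move/eqP: e; rewrite roots_cons => /and5P[_ hx /eqP e0 _ /eqP e1].
move: hx; rewrite in_itv /= => /andP[ax xb].
by rewrite big_cons (sgp_noroot ax F0 e0) addrA addrCA subrr addr0 IH.
Qed.

Lemma cauchy_index_inversion (R : rcfType) (F G : {poly R}) (a b : R) :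
  a < b -> F != 0 -> G != 0 ->
  ~~ (root F a && root G a) -> ~~ (root F b && root G b) ->
  cauchy_index G F a b + cauchy_index F G a b = var_between F G a b.
Proof.
move=> ab F0 G0 ra rb; rewrite /cauchy_index.
rewrite (cauchy_sum_mulr G a b F0 G0) (cauchy_sum_mulr F a b G0 F0).
rewrite [G * F]mulrC addrACA -opprD ind_left_inversion //.
rewrite addrACA ind_right_inversion // -big_split /=.
rewrite (eq_bigr (fun x => 2^-1 *
    (sgp_right (F * G) x - sgp_left (F * G) x))); last first.
  by move=> x _; apply: ind_at_inversion.
rewrite -big_distrr /= -(sgp_telescope ab (mulf_neq0 F0 G0)) /var_between.
ring.
Qed.

(** * Euclidean division and the Sturm sequence *)

Lemma mu_dvdp (R : rcfType) (F G : {poly R}) (x : R) :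
  G != 0 -> F %| G -> (\mu_x F <= \mu_x G)%N.
Proof. by move=> G0 dFG; rewrite -root_le_mu // (dvdp_trans (root_mu F x)). Qed.

(** Adding a multiple of F to G does not affect the leading term of G at a pole
of G / F, because the multiple vanishes at x to a higher order. *)
Lemma pole_add (R : rcfType) (F G A : {poly R}) (x : R) :
  G != 0 -> (\mu_x G < \mu_x F)%N ->
  \mu_x (A * F + G) = \mu_x G /\ sgp_right (A * F + G) x = sgp_right G x.
Proof.
move=> G0 lt; have [->|AF0] := eqVneq (A * F) 0; first by rewrite add0r.
have {}lt := leq_trans lt (mu_dvdp x AF0 (dvdp_mulIr A F)).
by rewrite mu_addl ?sgp_right_addp0.
Qed.

(** The relation between G and its remainder is symmetric (each is the other
plus a multiple of F), so [pole_add] applies in both directions. *)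
Lemma mu_modp_lt (R : rcfType) (F G : {poly R}) (x : R) :
  G != 0 -> G %% F != 0 ->
  (\mu_x (G %% F) < \mu_x F)%N = (\mu_x G < \mu_x F)%N.
Proof.
move=> G0 r0; apply/idP/idP => lt.
  by rewrite {1}(divp_eq G F); have [->] := pole_add (G %/ F) r0 lt.
have e : G %% F = - (G %/ F) * F + G.
  by rewrite {3}(divp_eq G F) mulNr addrA addNr add0r.
by rewrite {1}e; have [->] := pole_add (- (G %/ F)) G0 lt.
Qed.

Lemma pole_modp (R : rcfType) (F G : {poly R}) (x : R) :
  G != 0 -> G %% F != 0 -> (\mu_x G < \mu_x F)%N ->
  \mu_x (G %% F) = \mu_x G /\ sgp_right (G %% F) x = sgp_right G x.
Proof.
move=> G0 r0; rewrite -mu_modp_lt // => lt.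
by rewrite {2 4}(divp_eq G F); have [-> ->] := pole_add (G %/ F) r0 lt.
Qed.

Lemma ind0 (R : rcfType) (F : {poly R}) (x : R) :
  ind_right 0 F x = 0 /\ ind_left 0 F x = 0.
Proof.
rewrite /ind_right /ind_left /local_num div0p /strip_root div0p scaler0.
by rewrite horner0 mul0r sgr0 !mulr0; case: ifP.
Qed.

Lemma ind_modp (R : rcfType) (F G : {poly R}) (x : R) :
  F != 0 -> G != 0 ->
  ind_right (- (G %% F)) F x = - ind_right G F x /\
  ind_left (- (G %% F)) F x = - ind_left G F x.
Proof.
move=> F0 G0; have [r0|r0] := eqVneq (G %% F) 0.
  rewrite r0 oppr0; have [-> ->] := ind0 F x.
  rewrite ind_rightE // ind_leftE // ltnNge mu_dvdp ?oppr0 //.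
  by rewrite /dvdp r0.
rewrite !ind_rightE ?oppr_eq0 // !ind_leftE ?oppr_eq0 // mu_opp mu_modp_lt //.
case: ifP => [lt|_]; last by rewrite oppr0.
have [em es] := pole_modp G0 r0 lt.
rewrite /sgp_left !mulrN mu_opp !mu_mul ?mulf_neq0 // em.
by rewrite -scaleN1r sgp_right_scale sgrN1 !sgp_right_mul es; split; ring.
Qed.

Lemma cauchy_index_modp (R : rcfType) (F G : {poly R}) (a b : R) :
  F != 0 -> G != 0 ->
  cauchy_index (- (G %% F)) F a b = - cauchy_index G F a b.
Proof.
move=> F0 G0; rewrite /cauchy_index.
have [-> _] := ind_modp a F0 G0; have [_ ->] := ind_modp b F0 G0.
rewrite (eq_bigr (fun x => - ind_at G F x)) => [|x _].
  by rewrite sumrN; ring.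
by rewrite /ind_at; have [-> ->] := ind_modp x F0 G0; ring.
Qed.

Lemma cauchy_index0 (R : rcfType) (F : {poly R}) (a b : R) :
  cauchy_index 0 F a b = 0.
Proof.
rewrite /cauchy_index; have [-> _] := ind0 F a; have [_ ->] := ind0 F b.
rewrite big1 ?subr0 ?addr0 // => x _.
by rewrite /ind_at; have [-> ->] := ind0 F x; rewrite subr0.
Qed.

Lemma sturm_neq0 (R : rcfType) (P Q : {poly R}) (i : nat) :
  P != 0 -> (i <= sturm_length P Q)%N -> sturm P Q i != 0.
Proof.
move=> P0; case: i => [|i] //; rewrite /sturm_length.
by case: ex_minnP => m _ mP lt; apply: contraL lt => /mP; rewrite -leqNgt.
Qed.

Lemma sturm_length0 (R : rcfType) (P Q : {poly R}) :
  sturm P Q (sturm_length P Q).+1 = 0.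
Proof. by rewrite /sturm_length; case: ex_minnP => m /eqP. Qed.

(** A common root of S_{i+1} and S_{i+2} is a root of S_i by the division
identity, so common roots propagate back to P and Q. *)
Lemma sturm_not_common (R : rcfType) (P Q : {poly R}) (x : R) (i : nat) :
  ~~ (root P x && root Q x) ->
  ~~ (root (sturm P Q i) x && root (sturm P Q i.+1) x).
Proof.
move=> n; elim: i => [|i IH] //; apply: contra IH => /andP[r1 r2].
rewrite r1 andbT (divp_eq (sturm P Q i) (sturm P Q i.+1)).
move: r2; rewrite sturmSS rootN !rootE hornerD hornerM (rootP r1) mulr0 add0r.
by [].
Qed.

(** One Euclidean step:
  Ind(S_{i+1} / S_i) = Var(S_i, S_{i+1}) - Ind(S_i / S_{i+1})
                     = Var(S_i, S_{i+1}) + Ind(S_{i+2} / S_{i+1}),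
and the last quotient is 0. *)
Lemma cauchy_index_sturm (R : rcfType) (P Q : {poly R}) (a b : R) :
  a < b -> P != 0 -> 
  ~~ (root P a && root Q a) -> ~~ (root P b && root Q b) ->
  cauchy_index Q P a b =
  \sum_(0 <= i < sturm_length P Q)
     var_between (sturm P Q i) (sturm P Q i.+1) a b.
Proof.
move=> ab P0 na nb.
pose I i := cauchy_index (sturm P Q i.+1) (sturm P Q i) a b.
suff H n : (n <= sturm_length P Q)%N -> cauchy_index Q P a b =
    \sum_(0 <= i < n) var_between (sturm P Q i) (sturm P Q i.+1) a b + I n.
  by rewrite (H _ (leqnn _)) /I sturm_length0 cauchy_index0 addr0.
elim: n => [|n IH] lt; first by rewrite big_geq // add0r.
have S0 k : (k <= n.+1)%N -> sturm P Q k != 0.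
  by move=> le; apply: sturm_neq0 => //; apply: leq_trans le lt.
rewrite (IH (ltnW lt)) big_nat_recr //= -addrA; congr (_ + _).
rewrite /I sturmSS cauchy_index_modp ?S0 //.
by rewrite -cauchy_index_inversion ?addrK ?S0 // sturm_not_common.
Qed.

(** * Determinants of rows of polynomials *)

Definition rev_perm n : {perm 'I_n} := perm (@rev_ord_inj n).

(** Reversing n + 1 points is reversing n of them and moving the remaining one
from the first place to the last, across n points. *)
Lemma odd_rev_perm n : rev_perm n = odd 'C(n, 2) :> bool.
Proof.
elim: n => [|n IH].
  have -> : rev_perm 0 = 1%g by apply/permP => -[].
  by rewrite odd_perm1.
have -> : rev_perm n.+1 = lift_perm ord0 ord_max (rev_perm n).
  apply/permP => i; case: (unliftP ord0 i) => [k ->|->].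
    rewrite lift_perm_lift !permE; apply/val_inj => /=; rewrite /bump.
    by have := ltn_ord k; case: leqP; lia.
  by rewrite lift_perm_id permE; apply/val_inj; rewrite /= subn1.
by rewrite odd_lift_perm IH binS bin1 oddD addbC.
Qed.

Section RowDet.
Variable (R : comNzRingType) (j : nat).
Implicit Types (f g : nat -> {poly R}) (P Q A : {poly R}).

(** Coefficients of X^(j + N - 1), ..., X^(j + 1), then the polynomial itself in
the last column: a row of size N of the j-th subresultant matrix. The row is a
linear function of f, the property on which all the row operations below
rest. *)
Definition sres_entry N (f : {poly R}) l : {poly R} :=
  if l.+1 == N then f else (f`_(j + N.-1 - l))%:P.

Definition coef_rows_mx N f : 'M[{poly R}]_N :=
  \matrix_(k, l) sres_entry N (f k) l.

(** The rows are indexed by nat rather than by an ordinal, so that determinants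
of provably equal sizes can be compared without casts. *)
Definition row_det N f : {poly R} := \det (coef_rows_mx N f).

Lemma eq_row_det N f g : (forall k, (k < N)%N -> f k = g k) ->
  row_det N f = row_det N g.
Proof. by move=> e; congr (\det _); apply/matrixP => k l; rewrite !mxE e. Qed.

(** By linearity of [sres_entry], a scalar change of rows is a product of
matrices. *)
Lemma row_det_lin N (U : 'M[R]_N) f g :
  (forall k : 'I_N, g k = \sum_(i < N) U k i *: f i) ->
  row_det N g = (\det U)%:P * row_det N f.
Proof.
move=> e; rewrite /row_det -det_map_mx -det_mulmx; congr (\det _).
apply/matrixP => k l; rewrite !mxE e /sres_entry; case: ifP => lN.
  by apply: eq_bigr => i _; rewrite !mxE /sres_entry lN mul_polyC.
rewrite coef_sum rmorph_sum /=; apply: eq_bigr => i _.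
by rewrite !mxE coefZ polyCM /sres_entry lN.
Qed.

Lemma row_det_rev N f :
  row_det N (fun k => f (N - k.+1)%N) = (-1) ^+ 'C(N, 2) * row_det N f.
Proof.
rewrite -signr_odd -odd_rev_perm -det_perm -det_mulmx -row_permE.
by congr (\det _); apply/matrixP => k l; rewrite !mxE permE.
Qed.

(** Expansion along the first column, whose only nonzero entry is on top. The
hypothesis 0 < N ensures that this column is not the last one, which holds
polynomials instead of coefficients. *)
Lemma row_det_drop N f c : (0 < N)%N ->
  (f 0%N)`_(j + N) = c -> (forall k, (0 < k <= N)%N -> (f k)`_(j + N) = 0) ->
  row_det N.+1 f = c%:P * row_det N (f \o succn).
Proof.
move=> N0 e0 e; rewrite /row_det (expand_det_col _ ord0) big_ord_recl /=.
rewrite big1 => [|i _].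
  rewrite addr0 mxE /sres_entry /= subn0 e0 ifF; last by case: N N0 {e0 e}.
  congr (_ * _); rewrite /cofactor expr0 mul1r; congr (\det _).
  apply/matrixP => k l; rewrite !mxE /sres_entry /= /bump !leq0n !add1n eqSS.
  by case: eqP => // _; congr (_ `_ _)%:P; lia.
rewrite mxE /sres_entry /= subn0 e ?mul0r; last first.
  by rewrite /bump leq0n add1n ltn_ord.
by rewrite ifF ?polyC0 ?mul0r //; case: N N0 {e0 e i}.
Qed.

(** The generalized Sylvester rows: m shifts of P and n shifts of Q, where m and
n need not come from the degrees. Letting them vary independently of P and Q
makes it possible to replace P by its remainder first and shrink the matrix
afterwards. *)
Definition sylv_row m P Q k : {poly R} :=
  if (k < m)%N then 'X^(m - 1 - k) * P else 'X^(k - m) * Q.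

Definition sylv m n P Q : {poly R} := row_det (m + n) (sylv_row m P Q).

Lemma sylv_rowL m P Q k : (k < m)%N -> sylv_row m P Q k = 'X^(m - 1 - k) * P.
Proof. by rewrite /sylv_row => ->. Qed.

Lemma sylv_rowR m P Q k : sylv_row m P Q (m + k) = 'X^k * Q.
Proof. by rewrite /sylv_row ltnNge leq_addr /= addKn. Qed.

(** The rows of A Q are combinations of those of Q, provided that A is small
enough for X^(m - 1) A to have degree less than n; the change of rows is block
unitriangular. *)
Lemma sylv_addM m n P Q A : (size A + m <= n.+1)%N ->
  sylv m n (P + A * Q) Q = sylv m n P Q.
Proof.
move=> sA.
pose T := \matrix_(k < m, i < n) ('X^(m - 1 - k) * A)`_i.
rewrite /sylv (@row_det_lin _ (block_mx 1%:M T 0 1%:M) (sylv_row m P Q)).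
  by rewrite det_ublock !det1 mulr1 mul1r.
move=> k; rewrite big_split_ord /= -[k]splitK.
case: (split k) => k' /=.
  rewrite (bigD1 k') //= big1 => [|i ne]; last first.
    by rewrite block_mxEul mxE eq_sym (negPf ne) scale0r.
  rewrite block_mxEul mxE eqxx scale1r addr0 !sylv_rowL // mulrDr; congr (_ + _).
  under eq_bigr => i _ do rewrite block_mxEur mxE sylv_rowR scalerAl.
  rewrite -mulr_suml mulrA; congr (_ * _).
  rewrite -poly_def; apply/polyP => i; rewrite coef_poly.
  case: ltnP => // le; apply: nth_default.
  rewrite (leq_trans _ le) // (leq_trans (size_polyMleq _ _)) // size_polyXn.
  by have := ltn_ord k'; lia.
rewrite big1 ?add0r => [|i _]; last by rewrite block_mxEdl mxE scale0r.
rewrite (bigD1 k') //= big1 => [|i ne]; last first.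
  by rewrite block_mxEdr mxE eq_sym (negPf ne) scale0r.
by rewrite block_mxEdr mxE eqxx scale1r addr0 !sylv_rowR.
Qed.

(** The order of the rows makes exchanging P and Q the reversal of all the
rows. *)
Lemma sylv_swap m n P Q :
  sylv m n P Q = (-1) ^+ 'C(m + n, 2) * sylv n m Q P.
Proof.
rewrite /sylv [(n + m)%N]addnC -row_det_rev; apply: eq_row_det => k lt.
rewrite /sylv_row; case: ltnP => le; case: ltnP => le'; try lia.
  by congr ('X^_ * _); lia.
by congr ('X^_ * _); lia.
Qed.

Lemma sylvN m n P Q : sylv m n P (- Q) = (-1) ^+ n * sylv m n P Q.
Proof.
rewrite /sylv (@row_det_lin _ (block_mx 1%:M 0 0 (-1)%:M) (sylv_row m P Q)).
  by rewrite det_ublock det1 mul1r det_scalar rmorphXn rmorphN rmorph1.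
move=> k; rewrite big_split_ord /= -[k]splitK.
case: (split k) => k' /=.
  rewrite [X in _ = _ + X]big1 ?addr0 => [|i _]; last first.
    by rewrite block_mxEur mxE scale0r.
  rewrite (bigD1 k') //= big1 => [|i ne]; last first.
    by rewrite block_mxEul mxE eq_sym (negPf ne) scale0r.
  by rewrite block_mxEul mxE eqxx scale1r addr0 !sylv_rowL.
rewrite big1 ?add0r => [|i _]; last by rewrite block_mxEdl mxE scale0r.
rewrite (bigD1 k') //= big1 => [|i ne]; last first.
  by rewrite block_mxEdr mxE eq_sym (negPf ne) scale0r.
by rewrite block_mxEdr mxE eqxx scaleN1r addr0 !sylv_rowR mulrN.
Qed.

(** When the degree of Q is lower than the shape of the matrix allows, the top
row is the only one to reach the first column. *)
Lemma sylv_dropS m n P Q : (0 < n)%N -> size P = (j + n).+1 ->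
  (size Q <= (j + m).+1)%N ->
  sylv m.+1 n P Q = (lead_coef P)%:P * sylv m n P Q.
Proof.
move=> n0 sP sQ; rewrite /sylv addSn.
rewrite (@row_det_drop _ _ (lead_coef P)); first last.
- move=> k /andP[k0 kN]; rewrite /sylv_row; case: ltnP => lt; rewrite coefXnM.
    by case: ltnP => // le; apply: nth_default; rewrite sP; lia.
  by case: ltnP => // le; apply: nth_default; apply: leq_trans sQ _; lia.
- rewrite sylv_rowL // subn1 subn0 coefXnM /= lead_coefE sP /=.
  by rewrite ltnNge; case: leqP => le; [congr (_ `_ _)|]; lia.
- by rewrite addn_gt0 n0 orbT.
congr (_ * _); apply: eq_row_det => k _ /=.
by rewrite /sylv_row ltnS subSS; congr (if _ then 'X^_ * _ else _); lia.
Qed.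

Lemma sylv_drop m n e P Q : (0 < n)%N -> size P = (j + n).+1 ->
  (size Q <= (j + m).+1)%N ->
  sylv (e + m) n P Q = (lead_coef P ^+ e)%:P * sylv m n P Q.
Proof.
move=> n0 sP sQ; elim: e => [|e IH]; first by rewrite mul1r.
rewrite addSn sylv_dropS //; last by apply: leq_trans sQ _; lia.
by rewrite IH exprS rmorphM mulrA.
Qed.

Lemma sylv01 P Q : sylv 0 1 P Q = Q.
Proof.
by rewrite /sylv /row_det det_mx11 mxE /sres_entry (sylv_rowR 0 P Q 0) mul1r.
Qed.

End RowDet.

Lemma bin2D m n : 'C(m + n, 2) = ('C(m, 2) + 'C(n, 2) + m * n)%N.
Proof.
elim: m => [|m IH]; first by rewrite mul0n addn0.
by rewrite addSn !binS !bin1 IH; lia.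
Qed.

(** The sign of the reversal, corrected by the sign of m changes of sign, depends
only on n - m: this is how epsilon_{p - q} arises. *)
Lemma odd_bin2_split m n : (m <= n)%N ->
  odd ('C(n + m, 2) + m) = odd 'C(n - m, 2).
Proof.
move=> le; have -> : (n + m = (n - m) + (m + m))%N by lia.
rewrite !bin2D !oddD !oddM !oddD.
by case: (odd m); case: (odd 'C(m, 2)); case: (odd 'C(n - m, 2));
  case: (odd (n - m)).
Qed.

(** One Euclidean step on subresultants: replace P by its remainder, reverse the
rows, remove the rows made useless by the drop of degree, and change the sign of
the remainder. Truncated subtraction also covers j > r: no shift of Q is
then left. *)
Lemma sylv_modp (F : fieldType) (P Q : {poly F}) (j p q : nat) :
  size P = p.+1 -> size Q = q.+1 -> (j < q < p)%N ->
  let r := (size (P %% Q)).-1 in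
  sylv j (q - j) (p - j) P Q =
    ((-1) ^+ 'C(p - q, 2) * lead_coef Q ^+ ((p - j) - (r - j)))%:P
    * sylv j (r - j) (q - j) Q (- (P %% Q)).
Proof.
move=> sP sQ /andP[jq qp] /=; set r := (size _).-1.
have Q0 : Q != 0 by rewrite -size_poly_eq0 sQ.
have rq : (r < q)%N.
  move: (ltn_modp P Q); rewrite Q0 sQ /r.
  by case: (size _) => [|k] //= _; apply: leq_ltn_trans jq.
have eP : P %% Q = P + (- (P %/ Q)) * Q.
  by rewrite {2}(divp_eq P Q) mulNr addrAC subrr add0r.
rewrite -(@sylv_addM _ _ _ _ _ _ (- (P %/ Q))); last first.
  by rewrite size_polyN size_divp // sP sQ /=; lia.
rewrite -eP sylv_swap sylvN.
have -> : sylv j (p - j) (q - j) Q (P %% Q) =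
   sylv j (((p - j) - (r - j)) + (r - j)) (q - j) Q (P %% Q).
  by congr sylv; lia.
rewrite sylv_drop; first last.
- by apply: leq_trans (leqSpred _) _; rewrite -/r; lia.
- by rewrite sQ; lia.
- by lia.
rewrite !rmorphM !rmorphXn rmorphN rmorph1 /= !mulrA; congr (_ * _).
rewrite mulrAC; congr (_ * _).
rewrite -exprD -signr_odd -[in RHS]signr_odd; congr (_ ^+ nat_of_bool _).
have -> : (p - q = (p - j) - (q - j))%N by lia.
by rewrite oddD -odd_bin2_split ?oddD -?addbA ?addbb ?addbF 1?addnC //; lia.
Qed.

(** * Subresultants as multiples of Sturm remainders *)

Lemma sgr_sqr (R : rcfType) (x : R) : x != 0 -> Num.sg x ^+ 2 = 1.
Proof. by move=> x0; rewrite sqr_sg x0. Qed.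

(** By [var_at_half], Var_a^b is a difference of products of signs up to a
factor. *)
Lemma var_betweenZ (R : rcfType) (F G : {poly R}) (c d a b : R) :
  c != 0 -> d != 0 ->
  ~~ (root F a && root G a) -> ~~ (root F b && root G b) ->
  var_between (c *: F) (d *: G) a b =
  Num.sg c * Num.sg d * var_between F G a b.
Proof.
move=> c0 d0 na nb; rewrite /var_between !var_at_half ?rootZ // !hornerZ !sgrM.
by ring.
Qed.

Lemma epsB (R : rcfType) (m n : nat) :
  (n <= m)%N -> eps R (m%:Z - n%:Z) = (-1) ^+ 'C(m - n, 2).
Proof.
move=> le; rewrite /eps subzn // bin2 -divn2.
case: (m - n)%N => [|k] /=; first by rewrite mul0r div0z.
by rewrite intS addrAC subrr add0r -intS -PoszM divz_nat.
Qed.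

Section SturmCoefficients.
Variables (R : rcfType) (P Q : {poly R}).
Hypotheses (P0 : P != 0) (degQ : (pdeg Q < pdeg P)%N).

Let S := sturm P Q.
Let d := sturm_deg P Q.
Let s := sturm_length P Q.

Lemma size_sturm i : (i <= s)%N -> size (S i) = (d i).+1.
Proof.
move=> le; rewrite /d /sturm_deg /pdeg prednK // size_poly_gt0.
exact: sturm_neq0.
Qed.

Lemma lead_sturm_neq0 i : (i <= s)%N -> lead_coef (S i) != 0.
Proof. by move=> le; rewrite lead_coef_eq0 sturm_neq0. Qed.

Lemma sturm_deg_lt i : (i < s)%N -> (d i.+1 < d i)%N.
Proof.
case: i => [|i] lt; first exact: degQ.
rewrite -ltnS -(size_sturm lt) -(size_sturm (ltnW lt)) /S sturmSS.
by rewrite size_polyN ltn_modp sturm_neq0 // ltnW.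
Qed.

Lemma sturm_deg_le i k : (i <= k <= s)%N -> (d k <= d i)%N.
Proof.
case/andP; elim: k => [|k IH]; first by rewrite leqn0 => /eqP ->.
rewrite leq_eqVlt => /predU1P[-> // | lt] le.
by apply: leq_trans (IH lt (ltnW le)); apply/ltnW/sturm_deg_lt.
Qed.

(** The scalar collected by i Euclidean steps on the j-th subresultant, for j so
small that it does not affect the exponents. *)
Definition sres_prod i : R :=
  \prod_(k < i) ((-1) ^+ 'C(d k - d k.+1, 2)
                 * lead_coef (S k.+1) ^+ (d k - d k.+2)).

(** The ratio T_i / S_i. In the last step j = d_{i-1} - 1 exceeds or equals the
degree of the remainder, which is why the last exponent is not of the form
d_k - d_{k+2}. *)
Definition sres_coef i : R :=
  if i is i'.+2 then
    sres_prod i' * ((-1) ^+ 'C(d i' - d i'.+1, 2)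
                    * lead_coef (S i'.+1) ^+ (d i' - d i'.+1).+1)
  else 1.

Lemma sylv_sturm_step j k : (k.+1 < s)%N -> (j < d k.+1)%N ->
  sylv j (d k.+1 - j) (d k - j) (S k) (S k.+1) =
  ((-1) ^+ 'C(d k - d k.+1, 2)
   * lead_coef (S k.+1) ^+ ((d k - j) - (d k.+2 - j)))%:P
  * sylv j (d k.+2 - j) (d k.+1 - j) (S k.+1) (S k.+2).
Proof.
move=> ks jd; have k1s := ltnW ks; have k0s := ltnW k1s.
rewrite (sylv_modp (size_sturm k0s) (size_sturm k1s)) ?jd ?sturm_deg_lt //.
have -> : (size (S k %% S k.+1)).-1 = d k.+2.
  by rewrite /d /sturm_deg /pdeg sturmSS size_polyN.
by rewrite -sturmSS.
Qed.

Lemma sylv_sturm j k : (k < s)%N -> (j < d k)%N -> (j <= d k.+1)%N ->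
  sylv j (d 1 - j) (d 0 - j) P Q =
  (sres_prod k)%:P * sylv j (d k.+1 - j) (d k - j) (S k) (S k.+1).
Proof.
elim: k => [|k IH] ks jd jd1; first by rewrite /sres_prod big_ord0 mul1r.
have k1s := ltnW ks; have lt := sturm_deg_lt k1s.
rewrite (IH k1s (ltn_trans jd lt) (ltnW jd)).
rewrite sylv_sturm_step // mulrA -polyCM /sres_prod big_ord_recr /=.
have lt1 := sturm_deg_lt ks.
by congr ((_ * (_ * _ ^+ _))%:P * _); lia.
Qed.

Lemma sResP_sylv j : (j <= pdeg Q)%N ->
  sResP P Q j = sylv j (pdeg Q - j) (pdeg P - j) P Q.
Proof.
move=> jq; rewrite /sResP jq; congr (\det _); apply/matrixP => k l.
rewrite !mxE /sres_entry; case: ifP => // _.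
congr (_ `_ _)%:P.
by have := ltn_ord l; lia.
Qed.

(** With j = d_{i+1} - 1, the determinant for the pair (S_{i+1}, S_{i+2}) has
no shift of S_{i+2} to spare: a single row, equal to S_{i+2}, is left. *)
Lemma sres_T_sturm i : (i <= s)%N -> sres_T P Q i = sres_coef i *: S i.
Proof.
case: i => [|[|i]] le; first by rewrite scale1r.
  rewrite scale1r /= /sturm_deg /S sturm0 sturm1.
  case: (leqP (pdeg P).-1 (pdeg Q)) => h.
    have e : (pdeg P).-1 = pdeg Q by lia.
    rewrite sResP_sylv // e subnn; have -> : (pdeg P - pdeg Q = 1)%N by lia.
    exact: sylv01.
  rewrite /sResP leqNgt h /= eqxx.
  by case: eqP => // e; move: degQ; lia.
have le1 := ltnW le; have le0 := ltnW le1.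
have d1 := sturm_deg_lt le1; have d2 := sturm_deg_lt le.
have dq : (d i.+1 <= pdeg Q)%N by apply: (@sturm_deg_le 1 i.+1).
rewrite /= -/(d i.+1) -/(sres_prod i); set j := (d i.+1).-1.
rewrite sResP_sylv; last by lia.
rewrite (@sylv_sturm j i) //; try lia.
rewrite sylv_sturm_step //; last by lia.
have -> : (d i.+2 - j = 0)%N by lia.
have -> : (d i.+1 - j = 1)%N by lia.
rewrite sylv01 mulrA -polyCM mul_polyC.
by congr ((_ * (_ * _ ^+ _)) *: _); lia.
Qed.

Lemma sres_prod_neq0 i : (i < s)%N -> sres_prod i != 0.
Proof.
move=> lt; rewrite /sres_prod; apply/prodf_neq0 => k _.
rewrite mulf_neq0 ?expf_neq0 ?oppr_eq0 ?oner_eq0 // lead_sturm_neq0 //.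
by apply: leq_trans (ltn_ord k) (ltnW lt).
Qed.

Lemma sres_coef_neq0 i : (i <= s)%N -> sres_coef i != 0.
Proof.
case: i => [|[|i]] le; rewrite ?oner_eq0 //.
have lt := ltnW le.
by rewrite !mulf_neq0 ?sres_prod_neq0 ?expf_neq0 ?oppr_eq0 ?oner_eq0
   ?lead_sturm_neq0.
Qed.

(** * Signs of the ratios *)

Let u i := Num.sg (sres_coef i).
Let tau i := Num.sg (sres_t P Q i).

Lemma sgr_sres_t i : (0 < i <= s)%N -> tau i = u i * Num.sg (lead_coef (S i)).
Proof.
by case: i => // i /andP[_ le]; rewrite /tau /= -/(sres_T P Q i.+1)
  sres_T_sturm // lead_coefZ sgrM.
Qed.

Lemma sqr_sgr_coef i : (i <= s)%N -> u i ^+ 2 = 1.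
Proof. by move=> le; rewrite sgr_sqr // sres_coef_neq0. Qed.

Lemma sqr_sgr_sres_t i : (i <= s)%N -> tau i ^+ 2 = 1.
Proof.
case: i => [|i] le; first by rewrite /tau /= sgr1 expr1n.
by rewrite sgr_sres_t // exprMn sqr_sgr_coef // sgr_sqr ?mul1r ?lead_sturm_neq0.
Qed.

(** For i > 0 the base of the power is the product of the signs of the leading
coefficients of S_i and S_{i+1}. In c_{i+1} c_{i+2} the factors pair up into
squares, except for the last factor of c_{i+2} and d_i - d_{i+1} + 1 copies of
the leading coefficient of S_i. For i = 0 only the last factor of c_2 is left,
and the convention t_0 = 1 makes the base of the power the sign of the leading
coefficient of Q. *)
Lemma sgr_coef_step i : (i.+1 < s)%N ->
  u i.+1 * u i.+2 =
  (-1) ^+ 'C(d i - d i.+1, 2)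
  * (tau i * tau i.+1 * (u i * u i.+1)) ^+ (d i - d i.+1).+1.
Proof.
move=> lt; have le := ltnW lt; have le0 := ltnW le.
have sgS (n : nat) : Num.sg ((-1) ^+ n : R) = (-1) ^+ n by rewrite sgrX sgrN1.
case: i lt le le0 => [|i] lt le le0.
  rewrite (@sgr_sres_t 1 le) /u /tau /= /sres_prod big_ord0 sgr1 !mul1r.
  by rewrite ?sgr1 ?mul1r ?mulr1 sgrM sgS sgrX.
rewrite !sgr_sres_t //.
have -> : u i.+1 * Num.sg (lead_coef (S i.+1)) *
   (u i.+2 * Num.sg (lead_coef (S i.+2))) * (u i.+1 * u i.+2) =
   u i.+1 ^+ 2 * u i.+2 ^+ 2 *
   (Num.sg (lead_coef (S i.+1)) * Num.sg (lead_coef (S i.+2))) by ring.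
rewrite !sqr_sgr_coef // !mul1r exprMn.
have p2 : Num.sg (sres_prod i) ^+ 2 = 1.
  by rewrite sgr_sqr // sres_prod_neq0 // ltnW.
have l2 : Num.sg (lead_coef (S i.+1)) ^+ 2 = 1.
  by rewrite sgr_sqr // lead_sturm_neq0.
have d1 := sturm_deg_lt le0; have d2 := sturm_deg_lt le.
rewrite /u /= /sres_prod big_ord_recr /= -/(sres_prod i) !(sgrM, sgS, sgrX).
have -> : (d i - d i.+2 = (d i - d i.+1) + (d i.+1 - d i.+2))%N by lia.
move: (d i - d i.+1)%N (d i.+1 - d i.+2)%N => m n.
move: (lead_coef (S i.+1)) (lead_coef (S i.+2)) l2 => l l' l2.
have e2 : ((-1) ^+ 'C(m, 2)) ^+ 2 = 1 :> R by rewrite sqrr_sign.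
move: ('C(m, 2)) ('C(n, 2)) e2 => M N e2.
transitivity (Num.sg (sres_prod i) ^+ 2 * ((-1) ^+ M) ^+ 2
   * (Num.sg l ^+ 2) ^+ m
   * ((-1) ^+ N * (Num.sg l ^+ n.+1 * Num.sg l' ^+ n.+1))).
  by rewrite -[(Num.sg l ^+ 2) ^+ m]exprM mul2n -addnn !exprS !exprD; ring.
by rewrite p2 e2 l2 expr1n !mul1r.
Qed.

Lemma odd_indexS i : (i < s)%N ->
  odd_index P Q i.+1 = if odd (d i - d i.+1) then i.+1 else odd_index P Q i.
Proof.
move=> lt; rewrite /odd_index big_mkcond big_ord_recr -big_mkcond /=.
rewrite -/(d i) -/(d i.+1) subzn ?absz_nat; last exact/ltnW/sturm_deg_lt.
case: ifP => _; last by rewrite maxn0.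
apply/maxn_idPr/leqW/bigmax_leqP => k _.
by rewrite -ltnS.
Qed.

Lemma odd_index_le i : (odd_index P Q i <= i)%N.
Proof. by apply/bigmax_leqP => k _; rewrite -ltnS. Qed.

Lemma odd_index0 : odd_index P Q 0 = 0%N.
Proof. by apply/eqP; rewrite -leqn0 odd_index_le. Qed.

Lemma sturm_deg_pred_le i k : (i <= k <= s)%N ->
  (d k <= sturm_deg_pred P Q i)%N.
Proof.
case: i => [|i] /andP[ik ks] /=.
  by apply: leqW; apply: (@sturm_deg_le 0 k).
by apply: sturm_deg_le; rewrite ltnW.
Qed.

(** Induction on i by [sgr_coef_step]: at an odd drop of degree the power is a
square and p(i + 1) = i + 1; at an even drop p does not change and the power is
its own base. *)
Lemma sgr_coef_odd_index i : (i < s)%N ->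
  eps R ((sturm_deg_pred P Q (odd_index P Q i))%:Z - (d i)%:Z)
  * tau (odd_index P Q i) * tau i = u i * u i.+1.
Proof.
move=> lt; rewrite epsB; last first.
  by apply: sturm_deg_pred_le; rewrite odd_index_le ltnW.
elim: i lt => [|i IH] lt.
  rewrite odd_index0 /= /d /sturm_deg /u /tau /= sgr1 subSnn.
  by rewrite !mulr1.
have le := ltnW lt; have le0 := ltnW le.
rewrite sgr_coef_step // odd_indexS //.
have dl := sturm_deg_lt le.
have sq : (tau i * tau i.+1 * (u i * u i.+1)) ^+ 2 = 1.
  by rewrite !exprMn !sqr_sgr_sres_t // !sqr_sgr_coef // !mulr1.
rewrite -[in RHS](odd_double_half (_ - _).+1) /= -mul2n exprD exprM sq expr1n.
rewrite mulr1; case: ifPn => odl /=.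
  by rewrite -/(d i) mulr1 -mulrA -expr2 sqr_sgr_sres_t // mulr1.
rewrite -(IH le) expr1; set p := odd_index P Q i.
have dp : (d i <= sturm_deg_pred P Q p)%N.
  by apply: sturm_deg_pred_le; rewrite odd_index_le.
have e D : (-1) ^+ 'C(D + (d i - d i.+1), 2) =
    (-1) ^+ 'C(D, 2) * (-1) ^+ 'C(d i - d i.+1, 2) :> R.
  rewrite bin2D !exprD -[X in _ * X]signr_odd oddM (negPf odl) andbF.
  by rewrite mulr1.
have -> : (sturm_deg_pred P Q p - d i.+1 =
  (sturm_deg_pred P Q p - d i) + (d i - d i.+1))%N by lia.
rewrite e.
have t2 := sqr_sgr_sres_t le0.
transitivity (tau i ^+ 2 * ((-1) ^+ 'C(sturm_deg_pred P Q p - d i, 2) *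
  (-1) ^+ 'C(d i - d i.+1, 2) * tau p * tau i.+1)); first by rewrite t2 mul1r.
move: ((-1) ^+ 'C(_ - d i, 2)) ((-1) ^+ 'C(d i - _, 2)) => x y.
by move: (tau i) (tau p) (tau i.+1) => t t' t''; ring.
Qed.

End SturmCoefficients.

Theorem theorem18 (R : rcfType) (a b : R) (P Q : {poly R})
    (ltab : a < b) (P_neq0 : P != 0) (Q_neq0 : Q != 0)
    (degP : (1 <= pdeg P)%N) (degQ : (pdeg Q < pdeg P)%N)
    (not_common_a : ~~ (root P a && root Q a))
    (not_common_b : ~~ (root P b && root Q b)) :
  cauchy_index Q P a b =
    \sum_(0 <= i < sturm_length P Q)
      eps R ((sturm_deg_pred P Q (odd_index P Q i))%:Z
             - (sturm_deg P Q i)%:Z)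
      * Num.sg (sres_t P Q (odd_index P Q i))
      * Num.sg (sres_t P Q i)
      * var_between (sres_T P Q i) (sres_T P Q i.+1) a b.
Proof.
rewrite cauchy_index_sturm //; apply: eq_big_nat => i /andP[_ lt].
have le := ltnW lt.
rewrite !(sres_T_sturm P_neq0 degQ) //.
rewrite var_betweenZ ?sres_coef_neq0 ?sturm_not_common //.
rewrite (sgr_coef_odd_index P_neq0 degQ lt) mulrA mulrACA -!expr2.
by rewrite !sqr_sgr_coef // !mul1r.
Qed.
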